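(* Let $\psi:\mathbb{R}^n\to\mathbb{R}\cup\{+\infty\}$ be a proper and uniformly quasiconvex function with modulus $\phi$, and suppose that the interior of $\operatorname{dom}\psi$ is nonempty. If there exists $m\in\mathbb{N}$ with $m\ge2$ such that, for each $y\in\mathbb{R}^n$, $$\liminf_{\|x\|\to+\infty}\frac{\phi(\|x-y\|)}{\|x\|^m}>0,$$ then $\psi$ is $m$-supercoercive.
   Context: $\|\cdot\|$ is the Euclidean norm on $\mathbb{R}^n$; $\operatorname{dom}\psi=\{x:\psi(x)<+\infty\}$; $\psi$ is proper if $\operatorname{dom}\psi\ne\emptyset$. A modulus is an increasing function $\phi:[0,+\infty)\to[0,+\infty]$ (i.e. $s\le t$ implies $\phi(s)\le\phi(t)$) that vanishes only at $0$. A proper function $\psi$ with convex domain is uniformly quasiconvex with modulus $\phi$ if for all $x,y\in\operatorname{dom}\psi$ and $\lambda\in[0,1]$, $$\psi(\lambda x+(1-\lambda)y)+\lambda(1-\lambda)\phi(\|x-y\|)\le\max\{\psi(x),\psi(y)\}.$$ A proper function $\psi$ is $m$-supercoercive ($m\in\mathbb{N}$) if $\liminf_{\|x\|\to+\infty}\frac{\psi(x)}{\|x\|^m}>0$. *)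

(* Defs.v *)
From HB Require Import structures.
From mathcomp Require Import all_boot all_order all_algebra.
From mathcomp Require Import all_classical all_reals all_analysis.
Set Implicit Arguments.
Unset Strict Implicit.
Unset Printing Implicit Defensive.
Import Order.TTheory GRing.Theory Num.Theory.
Import numFieldNormedType.Exports.
Local Open Scope classical_set_scope.
Local Open Scope ring_scope.

(* The library norm on matrices is the sup norm, hence this definition. Both
   norms induce the same topology, so the library's [interior] is usable. *)
Definition enorm (R : realType) (n : nat) (x : 'rV[R]_n) : R :=
  Num.sqrt (\sum_(i < n) x ord0 i ^+ 2).

(* The filter "||x|| --> +oo" for the Euclidean norm. *)
Definition enorm_pinfty (R : realType) (n : nat) : set_system 'rV[R]_n :=
  filter_from [set: R] (fun M => [set x : 'rV[R]_n | M < enorm x]).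

Definition edomain (R : realType) (T : Type) (psi : T -> \bar R) : set T :=
  [set x | (psi x < +oo)%E].

(* For functions with values in ]-oo, +oo]; the absence of the value -oo is a
   constraint on the codomain and is stated separately. *)
Definition proper_function (R : realType) (T : Type) (psi : T -> \bar R) : Prop :=
  edomain psi !=set0.

(* A modulus is defined on [0, +oo[: the values of [phi] at negative reals are
   unconstrained and never used. *)
Definition modulus (R : realType) (phi : R -> \bar R) : Prop :=
  [/\ forall t, 0 <= t -> (0 <= phi t)%E,
      forall s t, 0 <= s -> s <= t -> (phi s <= phi t)%E
    & forall t, 0 <= t -> (phi t = 0%E <-> t = 0)].

(* When [lambda] is 0 or 1 and [phi] takes the value +oo, the product is 0
   (convention 0 * +oo = 0). *)
Definition uniformly_quasiconvex (R : realType) (n : nat)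
    (psi : 'rV[R]_n -> \bar R) (phi : R -> \bar R) : Prop :=
  [/\ proper_function psi,
      convex_set (edomain psi),
      modulus phi
    & forall (x y : 'rV[R]_n) (lambda : R),
        edomain psi x -> edomain psi y -> 0 <= lambda <= 1 ->
        (psi (lambda *: x + (1 - lambda) *: y)%R
           + (lambda * (1 - lambda))%:E * phi (enorm (x - y)%R)
         <= maxe (psi x) (psi y))%E].

Definition supercoercive (R : realType) (n m : nat)
    (psi : 'rV[R]_n -> \bar R) : Prop :=
  (0 < limf_einf (fun x => psi x / (enorm x ^+ m)%:E) (@enorm_pinfty R n))%E.

(* Main.v *)
(** Let [p] be an interior point of the domain. Sublevel sets of [psi] are
    convex, so [psi] is bounded above by some [C] on a box around [p]. If [z]
    is far from [p], then [p] lies between [z] and a point [y] of the box with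
    [p = l z + (1 - l) y] and [l ~ 1 / ||z - p||]; since [m >= 2], the term
    [l (1 - l) phi(||z - y||)] grows at least linearly in [||z - p||], so
    [psi z <= C] would make [psi p] arbitrarily negative. Hence [psi >= C] far
    from [p], although [psi] need not be bounded below near [p]. Applying
    quasiconvexity at the midpoint [z] of [x] and [p] then gives
    [psi x >= C + phi(||x - p||) / 4]. *)
Require Import Defs.
From HB Require Import structures.
From mathcomp Require Import all_boot all_order all_algebra.
From mathcomp Require Import all_classical all_reals all_analysis.
From mathcomp Require Import ring lra.
Set Implicit Arguments.
Unset Strict Implicit.
Import Order.TTheory GRing.Theory Num.Theory.
Import numFieldNormedType.Exports.
Local Open Scope classical_set_scope.
Local Open Scope ring_scope.

Lemma enorm_ge0 (R : realType) (n : nat) (x : 'rV[R]_n) : 0 <= enorm x.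
Proof. exact: sqrtr_ge0. Qed.

Lemma enorm_sqr (R : realType) (n : nat) (x : 'rV[R]_n) :
  enorm x ^+ 2 = \sum_(i < n) x ord0 i ^+ 2.
Proof. by rewrite sqr_sqrtr// sumr_ge0// => i _; rewrite sqr_ge0. Qed.

Lemma enormZ (R : realType) (n : nat) (k : R) (x : 'rV[R]_n) :
  enorm (k *: x) = `|k| * enorm x.
Proof.
rewrite /enorm -sqrtr_sqr -sqrtrM ?sqr_ge0// mulr_sumr.
by congr Num.sqrt; apply: eq_bigr => i _; rewrite mxE exprMn.
Qed.

Lemma ler_coord_enorm (R : realType) (n : nat) (x : 'rV[R]_n) (i : 'I_n) :
  `|x ord0 i| <= enorm x.
Proof.
rewrite -ler_sqr ?nnegrE ?enorm_ge0// enorm_sqr real_normK ?num_real// (bigD1 i)//= lerDl.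
by rewrite sumr_ge0// => j _; rewrite sqr_ge0.
Qed.

(** Coordinatewise the gap is the square [(x_i - 2 y_i)^2], so no Cauchy-Schwarz inequality is
    involved. *)
Lemma enorm_sqr_le (R : realType) (n : nat) (x y : 'rV[R]_n) :
  enorm x ^+ 2 <= 2 * enorm (x - y) ^+ 2 + 2 * enorm y ^+ 2.
Proof.
rewrite !enorm_sqr !mulr_sumr -big_split/=; apply: ler_sum => i _.
rewrite !mxE; have := sqr_ge0 (x ord0 i - 2 * y ord0 i); nra.
Qed.

Lemma enorm_sub_ge (R : realType) (n : nat) (x y : 'rV[R]_n) :
  4 * enorm y <= enorm x -> enorm x / 4 <= enorm (x - y).
Proof.
move=> xy; rewrite -ler_sqr ?nnegrE ?divr_ge0 ?enorm_ge0//.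
have := enorm_sqr_le x y; have := enorm_ge0 y; nra.
Qed.

(** Serves in both directions: to extract constants from the growth of [phi] and to conclude
    supercoercivity. *)
Lemma limf_einf_enorm_gt0 (R : realType) (n : nat) (f : 'rV[R]_n -> \bar R)
    (m : nat) :
  (0 < limf_einf (fun x => f x / (enorm x ^+ m)%:E) (@enorm_pinfty R n))%E <->
  exists e M : R, 0 < e /\
    forall x, M < enorm x -> ((e * enorm x ^+ m)%:E <= f x)%E.
Proof.
have divE (M e : R) x : 0 <= M -> M < enorm x ->
    (e%:E <= f x / (enorm x ^+ m)%:E)%E = ((e * enorm x ^+ m)%:E <= f x)%E.
  move=> M0 Mx; have x0 : 0 < enorm x ^+ m.
    by rewrite exprn_gt0// (le_lt_trans M0).
  by rewrite inver gt_eqF// lee_pdivlMr// EFinM.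
rewrite limf_einfE; split.
- move=> /ereal_sup_gt[_ [V [M _ MV] <-]] infV.
  have [e e0 eV] : exists2 e : R, 0 < e &
      (e%:E <= ereal_inf [set (f x / (enorm x ^+ m)%:E)%E | x in V])%E.
    (* The infimum may be [+oo]; then any positive real will do. *)
    case: (ereal_inf _) infV => [r|_|//]; first by exists r.
    by exists 1 => //; rewrite leey.
  (* A nonnegative threshold keeps the denominator [enorm x ^+ m] positive. *)
  exists e, (Num.max 0 M); split=> // x Mx.
  rewrite -(divE (Num.max 0 M)) ?le_max ?lexx//.
  apply: (le_trans eV); apply: ereal_inf_lbound; exists x => //.
  by apply: MV; rewrite /= (le_lt_trans _ Mx)// le_max lexx orbT.
- move=> [e [M [e0 eM]]].
  apply: (@lt_le_trans _ _ e%:E); first by rewrite lte_fin.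
  apply: le_ereal_sup_tmp.
  exists (ereal_inf [set (f x / (enorm x ^+ m)%:E)%E |
                      x in [set x | Num.max 0 M < enorm x]]).
    by exists [set x | Num.max 0 M < enorm x] => //; exists (Num.max 0 M).
  apply: le_ereal_inf_tmp => _ [x /= Mx <-].
  rewrite (divE (Num.max 0 M)) ?le_max ?lexx//; apply: eM.
  by rewrite (le_lt_trans _ Mx)// le_max lexx orbT.
Qed.

(** Real upper bounds place both points in the domain, and a real lower bound on [phi] avoids its
    possible value [+oo]. *)
Lemma uniformly_quasiconvex_le (R : realType) (n : nat)
    (psi : 'rV[R]_n -> \bar R) (phi : R -> \bar R) (x y : 'rV[R]_n)
    (l a b c : R) :
  uniformly_quasiconvex psi phi -> 0 <= l <= 1 ->
  (psi x <= a%:E)%E -> (psi y <= b%:E)%E -> (c%:E <= phi (enorm (x - y)%R))%E ->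
  (psi (l *: x + (1 - l) *: y)%R + (l * (1 - l) * c)%:E <= (Num.max a b)%:E)%E.
Proof.
move=> [_ _ _ uqc] /andP[l0 l1] xa yb cphi.
have xdom : edomain psi x by apply: le_lt_trans xa _; rewrite ltry.
have ydom : edomain psi y by apply: le_lt_trans yb _; rewrite ltry.
apply: le_trans (_ : (maxe (psi x) (psi y) <= _)%E); last first.
  by rewrite EFin_max ge_max !le_max xa yb orbT.
apply: le_trans (uqc x y l xdom ydom _); last by rewrite l0.
by rewrite leeD2l// EFinM lee_wpmul2l// lee_fin mulr_ge0// subr_ge0.
Qed.

Lemma quasiconvex_sublevel (R : realType) (n : nat)
    (psi : 'rV[R]_n -> \bar R) (phi : R -> \bar R) (x y : 'rV[R]_n) (l C : R) :
  uniformly_quasiconvex psi phi -> 0 <= l <= 1 ->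
  (psi x <= C%:E)%E -> (psi y <= C%:E)%E ->
  (psi (l *: x + (1 - l) *: y)%R <= C%:E)%E.
Proof.
move=> uqc l01 xC yC; have [_ _ [phi_ge0 _ _] _] := uqc.
have := uniformly_quasiconvex_le uqc l01 xC yC (phi_ge0 _ (enorm_ge0 _)).
by rewrite mulr0 adde0 maxxx.
Qed.

Section convex_hull_of_cross.
Context {R : realType} {n : nat} {A : set 'rV[R]_n} {p : 'rV[R]_n}.
Hypothesis A_convex : forall x y l, 0 <= l <= 1 -> A x -> A y ->
  A (l *: x + (1 - l) *: y).
Hypothesis Ap : A p.

(** The average is over [k.+1] points, [p] included. By induction, the last point enters with weight
    [1 / k.+2] and the previous average takes the rest. *)
Lemma convex_average (k : nat) (v : nat -> 'rV[R]_n) :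
  (forall i, (i < k)%N -> A (p + v i)) ->
  A (p + k.+1%:R^-1 *: \sum_(i < k) v i).
Proof.
elim: k => [|k IH] Av; first by rewrite big_ord0 scaler0 addr0.
have k0 : (0 : R) < k.+1%:R by rewrite ltr0n.
have Ak := IH (fun i ik => Av i (ltnW ik)).
have -> : p + k.+2%:R^-1 *: \sum_(i < k.+1) v i =
    (k.+2%:R^-1) *: (p + v k) +
    (1 - k.+2%:R^-1) *: (p + k.+1%:R^-1 *: \sum_(i < k) v i).
  rewrite big_ord_recr/=; set s := \sum_(i < k) _.
  apply/rowP => j; rewrite !mxE.
  have -> : (k.+2%:R : R) = k.+1%:R + 1 by rewrite natr1.
  by move: (k.+1%:R : R) k0 => K K0; field; rewrite !gt_eqF ?addr_gt0.
apply: A_convex => //; last exact: Av.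
by rewrite invr_ge0 ltW//= invf_le1// ler1n.
Qed.

(** [q] is the average of [p] and the [n] points [p + (n+1) (q - p)_i e_i]. Each lies on a segment
    of the cross because the box has half-width [r / (n+1)]. *)
Lemma box_in_convex (r : R) (q : 'rV[R]_n) :
  0 < r ->
  (forall i, A (p + r *: delta_mx ord0 i)) ->
  (forall i, A (p - r *: delta_mx ord0 i)) ->
  (forall i, `|(q - p) ord0 i| <= r / n.+1%:R) -> A q.
Proof.
move=> r0 Ar ANr qp.
have n0 : (0 : R) < n.+1%:R by rewrite ltr0n.
have Acoord (i : 'I_n) :
    A (p + (n.+1%:R * (q - p) ord0 i) *: delta_mx ord0 i).
  set t := _ * _; have : `|t| <= r.
    by rewrite normrM gtr0_norm// mulrC -ler_pdivlMr.
  rewrite ler_norml => /andP[tr1 tr2].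
  have -> : p + t *: delta_mx ord0 i =
     ((1 + t / r) / 2) *: (p + r *: delta_mx ord0 i) +
     (1 - (1 + t / r) / 2) *: (p - r *: delta_mx ord0 i).
    by apply/rowP => j; rewrite !mxE; field; rewrite gt_eqF.
  have : -1 <= t / r <= 1.
    by rewrite ler_pdivrMr// ler_pdivlMr// mulN1r mul1r tr1.
  by move=> /andP[? ?]; apply: A_convex => //; apply/andP; split; lra.
pose v (k : nat) : 'rV[R]_n :=
  if insub k is Some i then (n.+1%:R * (q - p) ord0 i) *: delta_mx ord0 i
  else 0.
have -> : q = p + n.+1%:R^-1 *: \sum_(i < n) v i.
  have vE (i : 'I_n) : v i = n.+1%:R *: ((q - p) ord0 i *: delta_mx ord0 i).
    by rewrite /v valK scalerA.
  under eq_bigr do rewrite vE.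
  rewrite -scaler_sumr scalerA mulVf ?gt_eqF// scale1r -row_sum_delta.
  by rewrite addrC subrK.
apply: convex_average => i ik; rewrite /v.
by case: insubP => [j _ _|_]; rewrite ?addr0.
Qed.

End convex_hull_of_cross.

(** [C] is the largest value of [psi] at [p] and at the [2n] tips of a cross inside the domain; the
    convex sublevel set of [C] then contains a box. *)
Lemma quasiconvex_bounded_above_near (R : realType) (n : nat)
    (psi : 'rV[R]_n -> \bar R) (phi : R -> \bar R) (p : 'rV[R]_n) :
  uniformly_quasiconvex psi phi -> (forall x, psi x != -oo%E) ->
  interior (edomain psi) p ->
  exists C r : R, [/\ 0 < r, (psi p <= C%:E)%E &
    forall q, (forall i, `|(q - p) ord0 i| <= r) -> (psi q <= C%:E)%E].
Proof.
move=> uqc psiNy /nbhs_ballP[e /= e0 pe].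
pose g x := fine (psi x).
have gE x : edomain psi x -> psi x = (g x)%:E.
  by rewrite /edomain/= => xdom; rewrite fineK// fin_numE psiNy lt_eqF.
have dom (s : R) i : `|s| < e -> edomain psi (p + s *: delta_mx ord0 i).
  move=> se; apply: pe; split=> // j k; rewrite /ball/= !mxE ord1 eqxx/=.
  rewrite opprD addrA subrr sub0r normrN normrM.
  by case: (_ == _); rewrite ?normr1 ?mulr1 ?normr0 ?mulr0.
have e2 : `|e / 2| < e by rewrite gtr0_norm ?divr_gt0//; lra.
have pdom : edomain psi p by apply: pe; exact: ballxx.
pose h (i : 'I_n) := Num.max (g (p + (e / 2) *: delta_mx ord0 i))
                            (g (p - (e / 2) *: delta_mx ord0 i)).
pose C := \big[Num.max/g p]_i h i.
have pC : (psi p <= C%:E)%E by rewrite gE// lee_fin bigmax_ge_id.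
exists C, (e / 2 / n.+1%:R); split=> //; first by rewrite !divr_gt0.
move=> q qp.
apply: (@box_in_convex R n [set x | (psi x <= C%:E)%E] p _ pC (e / 2)) => //.
- by move=> x y l l01; exact: quasiconvex_sublevel uqc l01.
- by rewrite divr_gt0.
- move=> i /=; rewrite gE; last exact: dom.
  by rewrite lee_fin (le_trans _ (le_bigmax _ h i))// le_max lexx.
- move=> i /=; rewrite -scaleNr gE; last by apply: dom; rewrite normrN.
  by rewrite lee_fin (le_trans _ (le_bigmax _ h i))// le_max scaleNr lexx orbT.
Qed.

Lemma quasiconvex_bounded_below_far (R : realType) (n m : nat)
    (psi : 'rV[R]_n -> \bar R) (phi : R -> \bar R) (p : 'rV[R]_n)
    (C r e M : R) :
  uniformly_quasiconvex psi phi -> psi p != -oo%E -> (2 <= m)%N ->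
  0 < r -> (psi p <= C%:E)%E ->
  (forall q, (forall i, `|(q - p) ord0 i| <= r) -> (psi q <= C%:E)%E) ->
  0 < e ->
  (forall x : 'rV[R]_n, M < enorm x ->
    ((e * enorm x ^+ m)%:E <= phi (enorm x))%E) ->
  exists D0 : R, forall z, D0 < enorm (z - p) -> (C%:E < psi z)%E.
Proof.
move=> uqc pNy m2 r0 pC boxC e0 growth.
have [a pa] : exists a : R, psi p = a%:E.
  by case: (psi p) pC pNy => // a _ _; exists a.
(* The bounds ensure in turn [(D + r) ^+ (m - 2) >= 1], growth of [phi] at [z - y], and
   [C - a < e * r * D]. *)
exists (Num.max (Num.max 1 M) ((C - a) / (e * r))) => z.
rewrite !gt_max -andbA; set D := enorm _ => /and3P[D1 DM Da].
rewrite ltNge; apply/negP => zC.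
have D0 : 0 < D by lra.
have Dr0 : 0 < D + r by lra.
have k0 : 0 < 1 + r / D by rewrite addr_gt0 ?divr_gt0.
(* [y] lies beyond [p] on the line from [z], at Euclidean distance [r] from [p], hence in the
   box. *)
pose y := p - (r / D) *: (z - p).
have yC : (psi y <= C%:E)%E.
  apply: boxC => i; rewrite /y addrAC subrr sub0r mxE normrN mxE normrM.
  rewrite gtr0_norm ?divr_gt0//.
  rewrite -mulrA -[leRHS]mulr1 ler_pM2l// ler_pdivrMl// mulr1.
  exact: ler_coord_enorm.
have zyE : z - y = (1 + r / D) *: (z - p).
  by rewrite /y scalerDl scale1r opprB addrA addrAC.
have zyn : enorm (z - y) = D + r.
  by rewrite zyE enormZ gtr0_norm// mulrDl mul1r divfK// gt_eqF.
pose l := r / (D + r).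
have l01 : 0 <= l <= 1.
  rewrite /l divr_ge0 ?(ltW r0) ?(ltW Dr0)//=.
  by rewrite ler_pdivrMr// mul1r lerDr ltW.
have pE : l *: z + (1 - l) *: y = p.
  apply/rowP => j; rewrite !mxE /l; field.
  by rewrite !gt_eqF.
have zyM : M < enorm (z - y) by rewrite zyn; lra.
have := uniformly_quasiconvex_le uqc l01 zC yC (growth _ zyM).
rewrite pE maxxx pa zyn -EFinD lee_fin.
(* Since [l * (1 - l) = r * D / (D + r) ^+ 2], two of the [m >= 2] powers cancel and a term linear
   in [D] remains. *)
have -> : l * (1 - l) * (e * (D + r) ^+ m) = e * r * D * (D + r) ^+ (m - 2).
  by rewrite -{1}(subnK m2) exprD /l; field; rewrite gt_eqF.
have : e * r * D <= e * r * D * (D + r) ^+ (m - 2).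
  apply: ler_peMr; first by rewrite !mulr_ge0// ltW.
  by apply: exprn_ege1; lra.
have : C - a < e * r * D by rewrite mulrC -ltr_pdivrMr ?mulr_gt0.
lra.
Qed.

Unset Implicit Arguments.
Theorem theorem3p18 (R : realType) (n : nat)
    (psi : 'rV[R]_n -> \bar R) (phi : R -> \bar R)
    (psi_gtNy : forall x, psi x != -oo%E)
    (psi_proper : proper_function psi)
    (psi_uqc : uniformly_quasiconvex psi phi)
    (int_dom : interior (edomain psi) !=set0)
    (m : nat) (m_ge2 : (2 <= m)%N)
    (phi_growth : forall y : 'rV[R]_n,
      (0 < limf_einf (fun x : 'rV[R]_n => phi (enorm (x - y)%R) / (enorm x ^+ m)%:E)
             (@enorm_pinfty R n))%E) :
  supercoercive m psi.
Proof.
have /limf_einf_enorm_gt0[e [M [e0 growth]]] := phi_growth 0.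
have {}growth (x : 'rV[R]_n) : M < enorm x ->
    ((e * enorm x ^+ m)%:E <= phi (enorm x))%E.
  by move=> /growth; rewrite subr0.
case: int_dom => p p_int.
have [C [r [r0 pC boxC]]] :=
  quasiconvex_bounded_above_near psi_uqc psi_gtNy p_int.
have [D0 farC] := quasiconvex_bounded_below_far psi_uqc (psi_gtNy p) m_ge2
  r0 pC boxC e0 growth.
apply/limf_einf_enorm_gt0.
(* [4 ^+ m] comes from [enorm (x - p) >= enorm x / 4]; the 8 is the midpoint factor 4 times a 2 that
   leaves room to absorb [C]. *)
pose d : R := e / 4 ^+ m / 8.
have d0 : 0 < d by rewrite !divr_gt0// exprn_gt0.
(* The bounds give, in order: [enorm x <= enorm x ^+ m]; the comparison of [x - p] with [x]; growth
   at [x - p] and a midpoint farther than [D0] from [p]; [C] absorbed. *)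
exists d, (Num.max (Num.max 1 (4 * enorm p))
  (Num.max (4 * Num.max M (2 * D0)) (`|C| / d))); split=> // x.
rewrite !gt_max -!andbA => /and4P[x1 xp xM xC].
have xpn := enorm_sub_ge (ltW xp).
have [xMp xDp] : M < enorm (x - p) /\ 2 * D0 < enorm (x - p).
  have : Num.max M (2 * D0) < enorm (x - p) by lra.
  by rewrite gt_max => /andP[].
have [-> |[b xb]] : psi x = +oo%E \/ exists b : R, psi x = b%:E.
  by case: (psi x) (psi_gtNy x) => // [b _|_]; [right; exists b | left].
  by rewrite leey.
have half01 : 0 <= (2^-1 : R) <= 1.
  by apply/andP; split; lra.
have xleb : (psi x <= b%:E)%E by rewrite xb.
have := uniformly_quasiconvex_le psi_uqc half01 xleb pC (growth _ xMp).
set z := _ *: x + _; have zC : (C%:E < psi z)%E.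
  apply: farC; have -> : z - p = 2^-1 *: (x - p).
    by apply/rowP => j; rewrite !mxE; field.
  by rewrite enormZ gtr0_norm//; lra.
move=> zb.
have : ((C + 2^-1 * (1 - 2^-1) * (e * enorm (x - p) ^+ m))%:E
        <= (Num.max b C)%:E)%E.
  by apply: le_trans zb; rewrite EFinD leeD2r// ltW.
have xm : enorm x ^+ m / 4 ^+ m <= enorm (x - p) ^+ m.
  by rewrite -expr_div_n ler_pXn2r ?nnegrE ?divr_ge0 ?enorm_ge0 ?(ltnW m_ge2).
have {}xm : 2 * (d * enorm x ^+ m)
    <= 2^-1 * (1 - 2^-1) * (e * enorm (x - p) ^+ m).
  have := ler_wpM2l (ltW e0) xm; rewrite /d; lra.
have dC : `|C| < d * enorm x ^+ m.
  apply: (@lt_le_trans _ _ (d * enorm x)); first by rewrite mulrC -ltr_pdivrMr.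
  by rewrite ler_pM2l// ler_eXnr ?(ltnW m_ge2)// ltW.
have Q0 : 0 < d * enorm x ^+ m by rewrite (le_lt_trans _ dC).
(* With [Q = d * enorm x ^+ m], the maximum is at least [C + 2 Q]. It cannot be [C] as [Q > 0], so
   [b >= C + 2 Q >= Q] because [|C| < Q]. *)
have := ler_norm (- C); rewrite normrN.
rewrite xb !lee_fin le_max => ? /orP[|]; lra.
Qed.
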